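(* Consider online preemptive weighted throughput maximization on $m$ unrelated machines, where every job has slack $\varepsilon>0$ (defined in the context), and where the optimal offline schedule is allowed to use migration. There exist an online algorithm and an absolute constant $C>0$ such that for every $\varepsilon>0$ and every instance with slack $\varepsilon$, the algorithm produces a feasible schedule whose total weight of jobs completed by their deadlines is at least $\frac{1}{C\max\{1,1/\varepsilon\}}$ times the maximum total weight of jobs completed by their deadlines in any feasible (possibly migratory) schedule of that instance. In other words, the algorithm is $\mathcal{O}\big(\frac1\varepsilon\big)$-competitive.
   Context: There are $m$ machines. Jobs arrive online over time: job $j$ is revealed at its release date $r_j$, together with its processing times $p_{ij}\in\mathbb{R}_{>0}\cup\{\infty\}$ on each machine $i\in\{1,\dots,m\}$, its weight $w_j> 0$, and its deadline $d_j$; the online algorithm has no information about a job before its release. Machine $i$ is eligible for $j$ if $p_{ij}<\infty$. Preemption is allowed, and migration is allowed: a job may be interrupted and resumed later, possibly on a different machine. If job $j$ receives a total of $q_{ij}$ time units on machine $i$, it completes when $\sum_{i=1}^m q_{ij}/p_{ij}=1$. In a feasible schedule each machine processes at most one job at a time, each job is processed by at most one machine at a time, and no job is processed before its release date. The objective (weighted throughput) is the total weight of jobs that complete by their deadlines. Slack assumption with parameter $\varepsilon>0$: for every job $j$ and every eligible machine $i$, $d_j-r_j\ge(1+\varepsilon)p_{ij}$. *)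

(* Defs.v *)
From HB Require Import structures.
From mathcomp Require Import all_boot all_order all_algebra.
From mathcomp Require Import all_classical all_reals.
From mathcomp Require Import ereal measure lebesgue_measure.
Set Implicit Arguments. Unset Strict Implicit. Unset Printing Implicit Defensive.
Import Order.TTheory GRing.Theory Num.Theory.
Local Open Scope classical_set_scope.
Local Open Scope ring_scope.

Section Sched.
Variables (R : realType) (m : nat).

(* A job: release date, deadline, weight, and processing time on every
   machine i : 'I_m; [None] encodes an infinite processing time
   (machine i not eligible). *)
Record job := Job {
  rel : R;
  dl  : R;
  wt  : R;
  ptime : 'I_m -> option R }.

(* An instance: a finite list of job identifiers (natural numbers) together
   with the data of each job.  Only identifiers in [ids] are jobs of the
   instance. *)
Record instance := Instance {
  ids : seq nat;
  dat : nat -> job }.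

Definition valid_instance (I : instance) : Prop :=
  forall j, j \in ids I ->
    0 < wt (dat I j) /\
    forall i x, ptime (dat I j) i = Some x -> 0 < x.

Definition has_slack (eps : R) (I : instance) : Prop :=
  forall j, j \in ids I -> forall i x, ptime (dat I j) i = Some x ->
    (1 + eps) * x <= dl (dat I j) - rel (dat I j).

(* A (preemptive, possibly migratory) schedule: at every time t, machine i
   processes job [S i t = Some j] or idles ([None]).  Each machine thus
   processes at most one job at a time by construction. *)
Definition schedule := 'I_m -> R -> option nat.

Definition feasible (I : instance) (S : schedule) : Prop :=
  [/\
      forall i j, measurable [set t | S i t = Some j],
      forall i t j, S i t = Some j -> j \in ids I /\ rel (dat I j) <= t &
      forall i i' t j, S i t = Some j -> S i' t = Some j -> i = i'].

Definition proc_by_deadline (I : instance) (S : schedule) (i : 'I_m) (j : nat)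
  : \bar R :=
  (@lebesgue_measure R) [set t | S i t = Some j /\ t <= dl (dat I j)].

Definition completed (I : instance) (S : schedule) (j : nat) : Prop :=
  (1%:E <= \sum_(i < m)
     match ptime (dat I j) i with
     | Some x => proc_by_deadline I S i j * (x^-1)%:E
     | None => 0%E
     end)%E.

Definition throughput (I : instance) (S : schedule) : R :=
  \sum_(j <- undup (ids I) | `[< completed I S j >]) wt (dat I j).

Definition revealed (I : instance) (t : R) (j : nat) : option job :=
  if (j \in ids I) && (rel (dat I j) <= t) then Some (dat I j) else None.

Definition online (alg : instance -> schedule) : Prop :=
  forall I I' (t : R), (forall j, revealed I t j = revealed I' t j) ->
    forall i s, s <= t -> alg I i s = alg I' i s.

End Sched.

(* Main.v *)
Require Import Defs.
From HB Require Import structures.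
From mathcomp Require Import all_boot all_order all_algebra.
From mathcomp Require Import all_classical all_reals.
From mathcomp Require Import ereal measure lebesgue_measure.
From mathcomp Require Import measurable_realfun lebesgue_integral.
From mathcomp Require Import ring lra.
Set Implicit Arguments. Unset Strict Implicit. Unset Printing Implicit Defensive.
Import Order.TTheory GRing.Theory Num.Theory.
Local Open Scope ring_scope.

(** Jobs are processed in order of release. A booking of a job on machine i is a
   window of length len = min(2p, d - r) inside [r, d], where p is the processing
   time on i; at each time a machine runs its densest active booking, the density
   being w / p. Two bookings whose windows meet on the same machine conflict unless
   the density of one exceeds that of the other by at least the gap 8w / (len - p)
   of the latter. A new job is booked, evicting all conflicting bookings, as soon as
   some window makes their total weight at most w / 4; otherwise it is rejected
   forever. As the gap depends on the slack of the individual job, the algorithm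
   need not know eps.

   Evictions lose at most a quarter of the booked weight. A surviving booking that
   fails loses more than len - p time units of its window to denser bookings, and
   at any time the gaps of the non-running active bookings telescope to at most
   the density being run, so failures lose at most another quarter. Half of the
   booked weight is thus completed.

   The work of an offline schedule is bounded machine by machine, which is why
   migration does not matter. Cut the window of a rejected job into slots of length
   len: each slot conflicts with bookings of total weight more than w / 4, all of
   density within a factor G = O(1 + 1/eps) of w / p. If one of them is as long as
   the job, it is charged directly: the volume around a booking k that can be
   charged to it is O(p_k). Otherwise a Vitali selection picks slots that are
   disjoint except for pairs whose densities differ by a factor 2, hence each
   booking is charged by O(G) selected slots. *)

(** * Auxiliary facts on finite sums and lists *)

Lemma ler_sum_subset (R : numDomainType) (T : eqType) (s1 s2 : seq T)
    (P1 P2 : pred T) (F : T -> R) :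
  uniq s1 -> {in s1, forall x, P1 x -> x \in s2 /\ P2 x} ->
  {in s2, forall x, 0 <= F x} ->
  \sum_(x <- s1 | P1 x) F x <= \sum_(x <- s2 | P2 x) F x.
Proof.
elim: s1 s2 => [|a s1 ih] s2 /=.
  by move=> _ _ F0; rewrite big_nil big_seq_cond sumr_ge0 // => x /andP[/F0].
case/andP=> as1 us1 sub F0.
have sub1 : {in s1, forall x, P1 x -> x \in s2 /\ P2 x}.
  by move=> x xs; apply: sub; rewrite inE xs orbT.
rewrite big_cons; case: ifP => [Pa|_]; last exact: ih.
have [as2 P2a] := sub a (mem_head _ _) Pa.
rewrite [leRHS](big_rem a) //= P2a lerD2l; apply: ih => //.
  move=> x xs Px; have [xs2 P2x] := sub1 x xs Px; split=> //.
  move: xs2; rewrite (perm_mem (perm_to_rem as2)) inE => /predU1P[xa|//].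
  by move: as1; rewrite -xa xs.
by move=> x /mem_rem/F0.
Qed.

Lemma uniq_map_inj (T U : eqType) (f : T -> U) (s : seq T) :
  uniq (map f s) -> {in s &, injective f}.
Proof.
elim: s => //= a s ih /andP[fa us] x y.
rewrite !inE => /predU1P[->|xs] /predU1P[->|ys] //.
- by move=> fE; rewrite fE map_f in fa.
- by move=> fE; rewrite -fE map_f in fa.
- exact: ih.
Qed.

(** * Charging *)

Section Combinatorics.
Variable R : realType.

Lemma seq_argmax (T : eqType) (f : T -> R) (s : seq T) :
  s != [::] -> exists2 x, x \in s & forall y, y \in s -> f y <= f x.
Proof.
elim: s => // a [|b s] ih _.
  by exists a; rewrite ?mem_head // => y; rewrite inE => /eqP ->.
have [//|x xs xmax] := ih.
have [fax|fxa] := leP (f a) (f x).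
  exists x => [|y]; first by rewrite inE xs orbT.
  by rewrite inE => /predU1P[->//|/xmax].
exists a => [|y]; first exact: mem_head.
rewrite inE => /predU1P[->//|/xmax fyx]; exact: le_trans fyx (ltW fxa).
Qed.

(* The gap g k separates v k from every larger value, so the gaps telescope. *)
Lemma sum_gaps_le (T : eqType) (v g : T -> R) (s : seq T) (M : R) :
  uniq s -> 0 <= M ->
  {in s, forall k, 0 <= v k} -> {in s, forall k, 0 < g k} ->
  {in s &, forall k l, k != l -> v k + g k <= v l \/ v l + g l <= v k} ->
  {in s, forall k, v k + g k <= M} ->
  \sum_(k <- s) g k <= M.
Proof.
have [n] := ubnP (size s); elim: n => // n ih in s M *.
move=> sz us M0 v0 g0 sep gM.
have [->|sN0] := eqVneq s [::]; first by rewrite big_nil.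
have [x xs xmax] := seq_argmax v sN0.
have subs y : y \in rem x s -> y \in s by move/mem_rem.
rewrite (perm_big _ (perm_to_rem xs)) big_cons /=.
have : \sum_(k <- rem x s) g k <= v x.
  apply: ih => //.
  - rewrite size_rem //; case: (s) xs sz => //= a l _; exact.
  - exact: rem_uniq.
  - exact: v0.
  - by move=> k /subs /v0.
  - by move=> k /subs /g0.
  - by move=> k l /subs ks /subs ls; exact: sep.
  - move=> k kr; have ks := subs _ kr.
    have kx : k != x by move: kr; rewrite mem_rem_uniq // inE => /andP[].
    case: (sep _ _ ks xs kx) => // h.
    by have := g0 _ xs; have := xmax _ ks; lra.
have := gM _ xs; lra.
Qed.

(** Taking every value as its own gap in [sum_gaps_le], the values up to a bound M sum to at most
    2M. Those at least r, with M = G r, number at most 2G; those below r, with M = r, are at least r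
    / G each and again number at most 2G. *)
Lemma separated_size_le (T : eqType) (v : T -> R) (s : seq T) (r G : R) :
  uniq s -> 0 < r -> 1 <= G ->
  {in s, forall y, 0 < v y} ->
  {in s &, forall y z, y != z -> 2 * v y <= v z \/ 2 * v z <= v y} ->
  {in s, forall y, v y <= G * r} -> {in s, forall y, r <= G * v y} ->
  (size s)%:R <= 4 * G.
Proof.
move=> us r0 G1 v0 sep vGr rGv.
have sumv (P : pred T) M : 0 <= M -> (forall y, y \in s -> P y -> v y <= M) ->
    \sum_(y <- s | P y) v y <= 2 * M.
  move=> M0 hM; rewrite -big_filter; apply: (@sum_gaps_le _ v).
  - exact: filter_uniq.
  - lra.
  - by move=> k; rewrite mem_filter => /andP[_ /v0 /ltW].
  - by move=> k; rewrite mem_filter => /andP[_ /v0].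
  - move=> k l; rewrite !mem_filter => /andP[_ ks] /andP[_ ls] kl.
    by case: (sep _ _ ks ls kl) => h; [left|right]; lra.
  - by move=> k; rewrite mem_filter => /andP[Pk /hM /(_ Pk)]; lra.
have rsize : r * (size s)%:R = \sum_(y <- s) r.
  by rewrite big_const_seq count_predT iter_addr_0 mulr_natr.
have r4 : r * (size s)%:R <= r * (4 * G).
  rewrite rsize (bigID (fun y => r <= v y)) /=.
  have h1 : \sum_(y <- s | r <= v y) r <= 2 * (G * r).
    apply: le_trans (sumv (fun y => r <= v y) (G * r) _ _); last first.
    - by move=> y /vGr.
    - by apply: mulr_ge0; lra.
    - exact: ler_sum.
  have h2 : \sum_(y <- s | ~~ (r <= v y)) r <= G * (2 * r).
    apply: (@le_trans _ _ (\sum_(y <- s | ~~ (r <= v y)) G * v y)).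
      by rewrite big_seq_cond [leRHS]big_seq_cond; apply: ler_sum => y /andP[/rGv].
    rewrite -mulr_sumr ler_pM2l; last lra.
    apply: sumv; first lra.
    by move=> y ys; rewrite -ltNge => /ltW.
  by move: h1 h2; lra.
by move: r4; rewrite ler_pM2l.
Qed.

(** Induction, setting aside an x with least p: whatever is selected from the rest is long enough to
    cover x. Then x is added only if no touching selected element covers it, and in that case v x
    exceeds twice the value of each of those. *)
Lemma vitali_selection (T : eqType) (touch : rel T) (p v : T -> R) (s : seq T) :
  symmetric touch -> reflexive touch -> uniq s -> {in s, forall x, 0 < v x} ->
  exists D : seq T, [/\ uniq D, {subset D <= s},
    forall x, x \in s -> exists2 y, y \in D &
      [/\ touch x y, p x <= p y & v x <= 2 * v y] &
    {in D &, forall y z, y != z -> touch y z ->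
      2 * v y <= v z \/ 2 * v z <= v y}].
Proof.
move=> tsym trefl.
have [n] := ubnP (size s); elim: n => // n ih in s * => sz us v0.
have [->|sN0] := eqVneq s [::]; first by exists [::].
have [x xs xmin] := seq_argmax (fun y => - p y) sN0.
have subs y : y \in rem x s -> y \in s by move/mem_rem.
have [||y /subs/v0//|D [uD Ds cover sep]] := ih (rem x s).
- by rewrite size_rem //; case: (s) xs sz => //= a l _; exact.
- exact: rem_uniq.
have xND : x \notin D.
  by apply/negP => /Ds; rewrite mem_rem_uniq // inE eqxx.
have coverD y : y \in s -> y != x -> exists2 z, z \in D &
    [/\ touch y z, p y <= p z & v y <= 2 * v z].
  by move=> ys yx; apply: cover; rewrite mem_rem_uniq // inE yx.
have [/hasP[y yD /andP[txy vxy]]|/hasPn hN] :=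
    boolP (has (fun y => touch x y && (v x <= 2 * v y)) D).
  exists D; split=> // [z /Ds/subs//|z zs].
  have [->|zx] := eqVneq z x; last exact: coverD.
  exists y => //; split => //.
  by have := xmin _ (subs _ (Ds _ yD)); rewrite lerN2.
have xsep y : y \in D -> touch x y -> 2 * v y <= v x.
  by move=> /hN; rewrite negb_and => /orP[/negP//|]; rewrite -ltNge => /ltW.
exists (x :: D); split => /=.
- by rewrite xND.
- by move=> z; rewrite inE => /predU1P[->//|/Ds/subs].
- move=> z zs; have [->|zx] := eqVneq z x.
    exists x; first exact: mem_head.
    by split=> //; have := v0 _ xs; lra.
  by have [w wD hw] := coverD _ zs zx; exists w => //; rewrite inE wD orbT.
- move=> y z; rewrite !inE => /predU1P[->|yD] /predU1P[->|zD].
  + by rewrite eqxx.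
  + by move=> _ t; right; exact: xsep.
  + by move=> _ t; left; apply: xsep => //; rewrite tsym.
  + exact: sep.
Qed.

Lemma sum_le_cover (T K : eqType) (s : seq T) (D : seq K) (P : pred T)
    (E : T -> K -> bool) (F : T -> R) :
  {in s, forall x, 0 <= F x} ->
  (forall x, x \in s -> P x -> exists2 y, y \in D & E x y) ->
  \sum_(x <- s | P x) F x <= \sum_(y <- D) \sum_(x <- s | P x && E x y) F x.
Proof.
move=> F0 cover.
have -> : \sum_(y <- D) \sum_(x <- s | P x && E x y) F x =
          \sum_(x <- s | P x) \sum_(y <- D | E x y) F x.
  rewrite (exchange_big_dep P) /=; last by move=> y x _ /andP[].
  by apply: eq_bigr => x Px; apply: eq_bigl => y; rewrite Px.
rewrite big_seq_cond [leRHS]big_seq_cond; apply: ler_sum => x /andP[xs Px].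
have [y yD Exy] := cover _ xs Px.
rewrite -big_filter (big_rem y) /=; last by rewrite mem_filter Exy.
by rewrite lerDl sumr_ge0 // => _ _; exact: F0.
Qed.

(* X lists rejected slots [tx, tx + lx] of density vx, in which an offline
   schedule does qx units of work; Q lists bookings [tk, tk + lk] of weight wk. *)
Lemma charging (T K : eqType) (X : seq T) (Q : seq K)
    (tx px lx vx qx : T -> R) (tk pk lk wk : K -> R)
    (conf : T -> K -> bool) (G : R) :
  1 <= G -> uniq X ->
  {in X, forall x, [/\ 0 < px x, lx x <= 2 * px x, 0 < vx x & 0 <= qx x]} ->
  {in X, forall x, 0 <= lx x} ->
  {in Q, forall k, [/\ 0 < pk k, 0 <= lk k, lk k <= 2 * pk k & 0 < wk k]} ->
  {in X & Q, forall x k, conf x k ->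
    [/\ tx x <= tk k + lk k, tk k <= tx x + lx x,
        vx x <= G * (wk k / pk k) & wk k / pk k <= G * vx x]} ->
  {in X, forall x, vx x * px x <= 4 * \sum_(k <- Q | conf x k) wk k} ->
  (forall a b, a <= b ->
    \sum_(x <- X | (a <= tx x) && (tx x + lx x <= b)) qx x <= b - a) ->
  \sum_(x <- X) vx x * qx x <= 454 * G * \sum_(k <- Q) wk k.
Proof.
move=> G1 uX hX lx0 hQ hconf hw hq.
have volume (P : pred T) a b V : a <= b -> 0 <= V ->
    (forall x, x \in X -> P x -> [/\ a <= tx x, tx x + lx x <= b & vx x <= V]) ->
    \sum_(x <- X | P x) vx x * qx x <= V * (b - a).
  move=> ab V0 hP.
  apply: (@le_trans _ _ (V * \sum_(x <- X | P x) qx x)).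
    rewrite mulr_sumr big_seq_cond [leRHS]big_seq_cond.
    apply: ler_sum => x /andP[xX Px]; have [_ _ _ q0] := hX _ xX.
    by apply: ler_wpM2r => //; have [] := hP _ xX Px.
  apply: ler_wpM2l => //; apply: le_trans (hq _ _ ab).
  rewrite big_seq_cond [leRHS]big_seq_cond.
  rewrite [leRHS](bigID P) /= -[leLHS]addr0.
  apply: lerD; last by apply: sumr_ge0 => x /andP[/andP[/hX[]]].
  rewrite le_eqVlt; apply/orP; left; apply/eqP; apply: eq_bigl => x.
  case xX: (x \in X) => //=; case Px: (P x); rewrite ?andbF ?andbT //.
  by have [-> ->] := hP _ xX Px.
have vq0 x : x \in X -> 0 <= vx x * qx x.
  by move=> /hX[_ _ v0 q0]; apply: mulr_ge0 => //; exact: ltW.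
have vk0 k : k \in Q -> 0 < wk k / pk k.
  by move=> /hQ[p0 _ _ w0]; exact: divr_gt0.
(* Slots in conflict with a booking at least as long as their job. *)
pose long x k := conf x k && (px x <= pk k).
pose isl x := has (long x) Q.
have caseA : \sum_(x <- X | isl x) vx x * qx x <= 6 * G * \sum_(k <- Q) wk k.
  apply: (@le_trans _ _ (\sum_(k <- Q) \sum_(x <- X | isl x && long x k)
                          vx x * qx x)).
    by apply: sum_le_cover => // x _ /hasP[k kQ lxk]; exists k.
  rewrite mulr_sumr big_seq [leRHS]big_seq; apply: ler_sum => k kQ.
  have [p0 l0 lp w0] := hQ _ kQ.
  have V0 : 0 <= G * (wk k / pk k).
    by apply: mulr_ge0; [lra|exact/ltW/vk0].
  (* The slots charged to k have length at most 2 [pk k], as has the booking k itself, so they all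
     lie in [tk - 2 pk, tk + 4 pk]. *)
  have -> : 6 * G * wk k =
      G * (wk k / pk k) * ((tk k + 4 * pk k) - (tk k - 2 * pk k)).
    by field; lra.
  apply: volume => //; first lra.
  move=> x xX /andP[_ /andP[cxk pxk]].
  have [px0 lxp _ _] := hX _ xX; have := lx0 _ xX.
  have [h1 h2 h3 _] := hconf _ _ xX kQ cxk.
  by move=> ?; split => //; lra.
(* The enlarged slots contain the windows of all (shorter) conflicting bookings, so
   that slots in conflict with a common booking touch. *)
pose touch x y := (tx x - 2 * px x <= tx y + lx y + 2 * px y) &&
                  (tx y - 2 * px y <= tx x + lx x + 2 * px x).
have tsym : symmetric touch by move=> x y; rewrite /touch andbC.
pose XB := [seq x <- X | ~~ isl x].
have XBP x : x \in XB -> x \in X /\ ~~ isl x.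
  by rewrite mem_filter => /andP[-> ->].
(* Outside [X] the relation [touch] need not be reflexive, hence the added equality. *)
pose touch' x y := (x == y) || touch x y.
have [D [uD DX cover sep]] : exists D : seq T, [/\ uniq D, {subset D <= XB},
    forall x, x \in XB -> exists2 y, y \in D &
      [/\ touch' x y, px x <= px y & vx x <= 2 * vx y] &
    {in D &, forall y z, y != z -> touch' y z ->
      2 * vx y <= vx z \/ 2 * vx z <= vx y}].
  apply: vitali_selection.
  - by move=> x y; rewrite /touch' eq_sym tsym.
  - by move=> x; rewrite /touch' eqxx.
  - exact: filter_uniq.
  - by move=> x /XBP[/hX[]].
have caseB : \sum_(x <- X | ~~ isl x) vx x * qx x <=
    448 * G * \sum_(k <- Q) wk k.
  apply: (@le_trans _ _ (\sum_(y <- D) \sum_(x <- X | ~~ isl x &&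
      [&& touch' x y, px x <= px y & vx x <= 2 * vx y]) vx x * qx x)).
    apply: sum_le_cover => // x xX nx.
    have [|y yD [h1 h2 h3]] := cover x; first by rewrite mem_filter nx.
    by exists y => //; apply/and3P.
  (* The slots covered by y lie in [ty - 6 py, ty + 8 py] and have density at most 2 vy, so their
     work weighs at most 28 vy py. By [hw] this is at most 28 times 4 times the weight in conflict
     with y. *)
  apply: (@le_trans _ _ (\sum_(y <- D) 112 * \sum_(k <- Q | conf y k) wk k)).
    rewrite big_seq [leRHS]big_seq; apply: ler_sum => y yD.
    have [yX _] := XBP _ (DX _ yD).
    have [py0 lyp vy0 _] := hX _ yX; have ly0 := lx0 _ yX.
    apply: (@le_trans _ _ (2 * vx y * ((tx y + 8 * px y) - (tx y - 6 * px y)))).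
      apply: volume; [lra|lra|] => x xX /andP[_ /and3P[txy pxy vxy]].
      have [px0 lxp _ _] := hX _ xX; have ? := lx0 _ xX.
      case/orP: txy => [/eqP ->|/andP[t1 t2]]; split => //; lra.
    have -> : 2 * vx y * (tx y + 8 * px y - (tx y - 6 * px y)) =
              28 * (vx y * px y) by ring.
    by have := hw _ yX; lra.
  rewrite -mulr_sumr (exchange_big_dep predT) //= mulr_sumr mulr_sumr.
  rewrite big_seq [leRHS]big_seq; apply: ler_sum => k kQ.
  have [p0 l0 lp w0] := hQ _ kQ.
  have -> : \sum_(i <- D | conf i k) wk k =
            wk k * (size [seq y <- D | conf y k])%:R.
    by rewrite big_const_seq iter_addr_0 size_filter mulr_natr.
  (* The selected slots in conflict with k belong to jobs longer than [pk k], so they touch one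
     another and their densities are separated by factors of 2. *)
  suff : (size [seq y <- D | conf y k])%:R <= 4 * G.
    move=> /(ler_wpM2l (ltW w0)); lra.
  have DP y : y \in [seq y <- D | conf y k] ->
      [/\ y \in D, y \in X, conf y k & pk k < px y].
    rewrite mem_filter => /andP[cyk yD]; have [yX /hasPn nl] := XBP _ (DX _ yD).
    by split=> //; move: (nl _ kQ); rewrite /long cyk /= -ltNge.
  apply: (@separated_size_le _ vx _ (wk k / pk k)) => //.
  - exact: filter_uniq.
  - exact: vk0.
  - by move=> y /DP[_ /hX[]].
  - move=> y z /DP[yD yX cy py] /DP[zD zX cz pz] yz; apply: sep => //.
    apply/orP; right.
    have [y1 y2 _ _] := hconf _ _ yX kQ cy; have [z1 z2 _ _] := hconf _ _ zX kQ cz.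
    by apply/andP; split; lra.
  - by move=> y /DP[_ yX cy _]; have [] := hconf _ _ yX kQ cy.
  - by move=> y /DP[_ yX cy _]; have [] := hconf _ _ yX kQ cy.
rewrite (bigID isl) /=; have := lerD caseA caseB; lra.
Qed.

End Combinatorics.

(** * Lebesgue measure of schedules *)

Section Volume.
Variable R : realType.
Local Open Scope classical_set_scope.
Notation mu := (@lebesgue_measure R).

(** [fine] sends an infinite measure to 0, which is why the comparisons below carry finiteness
    hypotheses. *)
Definition vol (A : set R) : R := fine (mu A).

(** Integrating both simple functions turns a comparison at every instant into one of total
    times. *)
Lemma measure_simple_le (I J : Type) (s : seq I) (s' : seq J)
    (A : I -> set R) (B : J -> set R) (c : I -> R) (d : J -> R) :
  (forall k, measurable (A k)) -> (forall k, measurable (B k)) ->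
  (forall k, 0 <= c k) -> (forall k, 0 <= d k) ->
  (forall t, \sum_(k <- s) c k * (t \in A k)%:R <=
             \sum_(k <- s') d k * (t \in B k)%:R) ->
  (\sum_(k <- s) (c k)%:E * mu (A k) <= \sum_(k <- s') (d k)%:E * mu (B k))%E.
Proof.
move=> mA mB c0 d0 cd.
have mf (K : Type) (C : K -> set R) (e : K -> R) : (forall k, measurable (C k)) ->
    forall k, measurable_fun [set: R] (fun t => (e k * (t \in C k)%:R)%:E).
  move=> mC k; apply/measurable_EFinP; apply: measurable_funM => //.
  exact: measurable_indic.
have int (K : Type) (C : K -> set R) (e : K -> R) (r : seq K) :
    (forall k, measurable (C k)) -> (forall k, 0 <= e k) ->
    (\sum_(k <- r) (e k)%:E * mu (C k) =
     \int[mu]_t (\sum_(k <- r) (e k * (t \in C k)%:R)%:E))%E.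
  move=> mC e0; rewrite ge0_integral_sum //.
  - apply: eq_bigr => k _.
    under eq_integral do rewrite EFinM.
    rewrite ge0_integralZl_EFin //.
      by rewrite integral_indic ?setIT //; exact: mC.
    by apply/measurable_EFinP; apply: measurable_indic; exact: mC.
  - exact: mf.
  - by move=> k t _; rewrite lee_fin mulr_ge0.
rewrite !int //; apply: ge0_le_integral => //.
- by move=> t _; apply: sume_ge0 => k _; rewrite lee_fin mulr_ge0.
- by apply: emeasurable_sum => k; exact: mf.
- by apply: emeasurable_sum => k; exact: mf.
- by move=> t _; rewrite !sumEFin lee_fin.
Qed.

Lemma vol_simple_le (I J : eqType) (s : seq I) (s' : seq J)
    (A : I -> set R) (B : J -> set R) (c : I -> R) (d : J -> R) :
  (forall k, measurable (A k)) -> (forall k, measurable (B k)) ->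
  (forall k, mu (A k) < +oo)%E -> (forall k, mu (B k) < +oo)%E ->
  {in s, forall k, 0 <= c k} -> {in s', forall k, 0 <= d k} ->
  (forall t, \sum_(k <- s) c k * (t \in A k)%:R <=
             \sum_(k <- s') d k * (t \in B k)%:R) ->
  \sum_(k <- s) c k * vol (A k) <= \sum_(k <- s') d k * vol (B k).
Proof.
move=> mA mB fA fB c0 d0 cd.
(* Coefficients are known to be nonnegative only on the lists; [cut] sets them to 0 elsewhere. *)
pose cut (K : eqType) (r : seq K) (e : K -> R) k := if k \in r then e k else 0.
have cutE (K : eqType) (r : seq K) (e F : K -> R) :
    \sum_(k <- r) e k * F k = \sum_(k <- r) cut K r e k * F k.
  by apply: eq_big_seq => k kr; rewrite /cut kr.
have cut0 (K : eqType) (r : seq K) (e : K -> R) :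
    {in r, forall k, 0 <= e k} -> forall k, 0 <= cut K r e k.
  by move=> e0 k; rewrite /cut; case: ifP => // /e0.
rewrite cutE [leRHS]cutE -lee_fin -!sumEFin.
have volE (K : eqType) (C : K -> set R) (e : K -> R) (r : seq K) :
    (forall k, mu (C k) < +oo)%E ->
    (\sum_(k <- r) (e k * vol (C k))%:E = \sum_(k <- r) (e k)%:E * mu (C k))%E.
  move=> fC; apply: eq_bigr => k _.
  by rewrite EFinM fineK // ge0_fin_numE.
rewrite !volE //; apply: measure_simple_le => //; [exact: cut0|exact: cut0|].
by move=> t; rewrite -!cutE.
Qed.

Lemma sum_indicator_le (T : eqType) (s : seq T) (A : T -> set R) (B : set R) t :
  uniq s ->
  {in s &, forall x y, t \in A x -> t \in A y -> x = y} ->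
  {in s, forall x, t \in A x -> t \in B} ->
  \sum_(x <- s) (t \in A x)%:R <= (t \in B)%:R :> R.
Proof.
move=> us dis sub.
have [/hasP[x xs tx]|/hasPn hN] := boolP (has (fun x => t \in A x) s).
  rewrite (big_rem x) //= tx (sub _ xs tx) big_seq big1 ?addr0 // => y.
  rewrite mem_rem_uniq // inE => /andP[yx ys].
  case ty: (t \in A y) => //; by rewrite (dis _ _ ys xs ty tx) eqxx in yx.
by rewrite big_seq big1 // => x /hN /negbTE ->.
Qed.

Lemma sum_vol_le (T : eqType) (s : seq T) (A : T -> set R) (B : set R) :
  uniq s -> (forall x, measurable (A x)) -> measurable B ->
  (forall x, mu (A x) < +oo)%E -> (mu B < +oo)%E ->
  (forall t, {in s &, forall x y, t \in A x -> t \in A y -> x = y}) ->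
  (forall t, {in s, forall x, t \in A x -> t \in B}) ->
  \sum_(x <- s) vol (A x) <= vol B.
Proof.
move=> us mA mB fA fB dis sub.
have -> : \sum_(x <- s) vol (A x) = \sum_(x <- s) 1 * vol (A x).
  by apply: eq_bigr => x _; rewrite mul1r.
have -> : vol B = \sum_(x <- [:: tt]) 1 * vol B by rewrite big_seq1 mul1r.
apply: vol_simple_le => // t; rewrite big_seq1 mul1r.
under eq_bigr do rewrite mul1r.
exact: sum_indicator_le us (dis t) (sub t).
Qed.

Lemma vol_le_sum (T : eqType) (s : seq T) (A : set R) (B : T -> set R) :
  measurable A -> (forall x, measurable (B x)) ->
  (mu A < +oo)%E -> (forall x, mu (B x) < +oo)%E ->
  (forall t, A t -> exists2 x, x \in s & B x t) ->
  vol A <= \sum_(x <- s) vol (B x).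
Proof.
move=> mA mB fA fB cover.
have -> : \sum_(x <- s) vol (B x) = \sum_(x <- s) 1 * vol (B x).
  by apply: eq_bigr => x _; rewrite mul1r.
have -> : vol A = \sum_(x <- [:: tt]) 1 * vol A by rewrite big_seq1 mul1r.
apply: vol_simple_le => // t; rewrite big_seq1 mul1r.
under eq_bigr do rewrite mul1r.
case tA: (t \in A); last exact: sumr_ge0.
have [x xs tx] := cover t (set_mem tA).
rewrite (big_rem x) //= (_ : t \in B x); last by rewrite inE.
by rewrite lerDl; apply: sumr_ge0.
Qed.

Lemma mu_itv_lty (i : bool) (j : bool) (a b : R) (A : set R) :
  measurable A -> A `<=` [set` Interval (BSide i a) (BSide j b)] -> (mu A < +oo)%E.
Proof.
move=> mA Aab.
have le : (mu A <= mu [set` Interval (BSide i a) (BSide j b)])%E.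
  by apply: le_measure; rewrite ?inE //; exact: measurable_itv.
apply: le_lt_trans le _.
by rewrite lebesgue_measure_itv /=; case: ifP => // _; rewrite -EFinD ltry.
Qed.

Lemma vol_itv (i : bool) (j : bool) (a b : R) : a <= b ->
  vol [set` Interval (BSide i a) (BSide j b)] = b - a.
Proof.
move=> ab; rewrite /vol lebesgue_measure_itv /= lte_fin.
case: ltP => //= ba; have -> : a = b by apply/le_anti; rewrite ab.
by rewrite subrr.
Qed.

(** Such a set is a finite union of cells cut out by the half-lines [c, +oo[; the induction removes
    one threshold at a time. *)
Lemma measurable_thresholds (cs : seq R) (Q : set R) :
  (forall t t', Q t -> {in cs, forall c, (c <= t) = (c <= t')} -> Q t') ->
  measurable Q.
Proof.
elim: cs Q => [|c cs ih] Q hQ.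
  have [[t Qt]|Q0] := pselect (exists t, Q t).
    have -> : Q = setT by apply/seteqP; split => // t' _; exact: hQ Qt _.
    exact: measurableT.
  have -> : Q = set0 by apply/seteqP; split => // t Qt; apply: Q0; exists t.
  exact: measurable0.
pose E : set R := [set t | c <= t].
(* The saturation of Q ∩ F under the remaining thresholds, to which the induction hypothesis
   applies. *)
pose near (F : set R) : set R :=
  [set t | exists t', [/\ Q t', F t' & {in cs, forall c, (c <= t') = (c <= t)}]].
have mnear F : measurable (near F).
  apply: ih => t t' [u [Qu Fu ut]] tt'; exists u; split=> // e ecs.
  by rewrite ut // tt'.
have mE : measurable E.
  have -> : E = [set` `[c, +oo[%R] by apply/seteqP; split => t /=; rewrite in_itv /= andbT.
  exact: measurable_itv.
have -> : Q = (near E `&` E) `|` (near (~` E) `&` ~` E).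
  apply/seteqP; split => [t Qt|t].
    by have [Et|nEt] := pselect (E t); [left|right]; split => //; exists t.
  case=> -[[u [Qu]]] => [Eu ut Et|nEu ut nEt]; apply: (hQ u) => // e;
    rewrite inE => /predU1P[->|/ut //].
    by move: Eu Et; rewrite /E /= => -> ->.
  by move/negP/negbTE: nEu => ->; move/negP/negbTE: nEt => ->.
by apply: measurableU; apply: measurableI => //; apply: measurableC.
Qed.

Lemma measurable_le_set (d : R) : measurable [set t : R | t <= d].
Proof.
rewrite (_ : mkset _ = [set` `]-oo, d]%R]); first exact: measurable_itv.
by apply/seteqP; split => t /=; rewrite in_itv.
Qed.

End Volume.

(** * The algorithm *)

Section Algorithm.
Variables (R : realType) (m : nat).
Notation job := (job R m).

HB.instance Definition _ := gen_eqMixin job.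

(** A booking carries the job data itself, so that plans depend on the processed arrivals only and
    not on the whole instance. *)
Record booking := Booking {
  bid : nat;
  bjob : job;
  bmach : 'I_m;
  bstart : R }.

HB.instance Definition _ := gen_eqMixin booking.

Definition bwt b := wt (bjob b).
(** The default 0 stands for an ineligible machine, which [admissible] excludes. *)
Definition bproc b := odflt 0 (ptime (bjob b) (bmach b)).
Definition bdens b := bwt b / bproc b.
Definition blen b := Num.min (2 * bproc b) (dl (bjob b) - Defs.rel (bjob b)).
Definition bend b := bstart b + blen b.
Definition bgap b := 8 * bwt b / (blen b - bproc b).

(* Whenever k and l are active together, l is run in preference to k. *)
Definition above k l := bdens k + bgap k <= bdens l.

Definition conflict k l :=
  [&& bmach k == bmach l, bstart k < bend l, bstart l < bend k,
      ~~ above k l & ~~ above l k].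

Definition admissible b :=
  [&& isSome (ptime (bjob b) (bmach b)),
      Defs.rel (bjob b) <= bstart b & bend b <= dl (bjob b)].

Definition fits (P : seq booking) b :=
  admissible b && (4 * \sum_(k <- P | conflict b k) bwt k <= bwt b).

(* A state is the current plan together with all bookings ever made; the
   second component is only used in the analysis. *)
Definition state := (seq booking * seq booking)%type.

(** Machine and start are picked by classical choice among all fitting bookings. The choice is a
    function of the state and the arriving job, hence compatible with [online]. *)
Definition step (st : state) (x : nat * job) : state :=
  match pselect (exists b, (bid b, bjob b) = x /\ fits st.1 b) with
  | left e => let b := sval (cid e) in
      (b :: [seq k <- st.1 | ~~ conflict b k], b :: st.2)
  | right _ => st
  end.

Definition plan (l : seq (nat * job)) : state := foldl step ([::], [::]) l.

Definition earlier (x y : nat * job) := Defs.rel x.2 <= Defs.rel y.2.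

(** Sorting by identifier first makes the result independent of the order of [ids]; the second sort
    is stable, so ties in the release date are broken by identifier. *)
Definition arrivals (I : instance R m) (P : pred job) : seq (nat * job) :=
  sort earlier [seq (j, dat I j) | j <-
    sort leq [seq j <- undup (ids I) | P (dat I j)]].

Definition active (P : seq booking) (i : 'I_m) (t : R) :=
  [seq b <- P | (bmach b == i) && (bstart b <= t < bend b)].

(* Densities of simultaneously active bookings of a plan are distinct, so at most
   one candidate survives the filter. *)
Definition densest (s : seq booking) : option booking :=
  ohead [seq b <- s | all (fun k => bdens k <= bdens b) s].

Definition released (I : instance R m) (t : R) : seq (nat * job) :=
  arrivals I (fun x => Defs.rel x <= t).

Definition run (I : instance R m) (i : 'I_m) (t : R) : option booking :=
  densest (active (plan (released I t)).1 i t).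

Definition alg (I : instance R m) : schedule R m :=
  fun i t => omap bid (run I i t).

(** * Invariants of the plan *)

Lemma conflictC k l : conflict k l = conflict l k.
Proof.
rewrite /conflict eq_sym; case: (bmach l == bmach k) => //=.
by case: (bstart k < bend l); case: (bstart l < bend k) => //=; rewrite andbC.
Qed.

Lemma stepP st x :
  (exists b, [/\ (bid b, bjob b) = x, fits st.1 b &
     step st x = (b :: [seq k <- st.1 | ~~ conflict b k], b :: st.2)]) \/
  ((forall b, (bid b, bjob b) = x -> ~~ fits st.1 b) /\ step st x = st).
Proof.
rewrite /step; case: pselect => [e|n]; [left|right].
  by case: cid => b [bx fb] /=; exists b.
split=> // b bx; apply/negP => fb; apply: n; by exists b.
Qed.

Lemma plan_rcons l x : plan (rcons l x) = step (plan l) x.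
Proof. by rewrite /plan foldl_rcons. Qed.

Lemma plan_booked_sub l l' : {subset (plan l).2 <= (plan (l ++ l')).2}.
Proof.
elim/last_ind: l' => [|l' x ih]; first by rewrite cats0.
rewrite -rcons_cat plan_rcons => b /ih bin.
have [[c [_ _ ->]]|[_ -> //]] := stepP (plan (l ++ l')) x.
by rewrite inE bin orbT.
Qed.

Lemma plan_live_cat l l' b : b \in (plan (l ++ l')).1 ->
  b \in (plan l).1 \/ (bid b, bjob b) \in l'.
Proof.
elim/last_ind: l' => [|l' x ih]; first by rewrite cats0; left.
rewrite -rcons_cat plan_rcons mem_rcons inE.
have [[c [<- _ ->]]|[_ ->]] := stepP (plan (l ++ l')) x.
  rewrite inE mem_filter => /predU1P[->|/andP[_ /ih[]]].
  - by right; rewrite eqxx.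
  - by left.
  - by move=> ->; right; rewrite orbT.
by case/ih => [|->]; [left|right; rewrite orbT].
Qed.

(** [rejected_conflict] counts all bookings ever made instead of the live ones, so that later
    evictions cannot destroy it. *)
Record plan_spec (l : seq (nat * job)) : Prop := PlanSpec {
  live_booked : subseq (plan l).1 (plan l).2;
  booked_uniq : uniq (map bid (plan l).2);
  booked_in : {in (plan l).2, forall b, (bid b, bjob b) \in l};
  booked_admissible : {in (plan l).2, forall b, admissible b};
  live_separated : {in (plan l).1 &, forall k k', k != k' -> ~~ conflict k k'};
  booked_le_live :
    3 * \sum_(b <- (plan l).2) bwt b <= 4 * \sum_(b <- (plan l).1) bwt b;
  rejected_conflict : forall b, (bid b, bjob b) \in l ->
    bid b \notin map bid (plan l).2 -> admissible b ->
    bwt b < 4 * \sum_(k <- (plan l).2 | conflict b k) bwt k }.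

Lemma planP l : uniq (map fst l) -> {in l, forall x, 0 < wt x.2} -> plan_spec l.
Proof.
elim/last_ind: l => [|l x ih] ulx wlx.
  by split => //=; rewrite !big_nil !mulr0.
have [ul wl] : uniq (map fst l) /\ {in l, forall y, 0 < wt y.2}.
  split; first by move: ulx; rewrite map_rcons rcons_uniq => /andP[].
  by move=> y yl; apply: wlx; rewrite mem_rcons inE yl orbT.
have xl : x.1 \notin map fst l.
  by move: ulx; rewrite map_rcons rcons_uniq => /andP[].
have [sub uA inA adA sep le43 rej] := ih ul wl.
have wx : 0 < wt x.2 by apply: wlx; rewrite mem_rcons mem_head.
have wA k : k \in (plan l).2 -> 0 < bwt k by move=> /inA /wl.
have wP k : k \in (plan l).1 -> 0 < bwt k by move=> /(mem_subseq sub)/wA.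
have inl y : y \in l -> y \in rcons l x by rewrite mem_rcons inE => ->; rewrite orbT.
have [[c [cx /andP[adc fc] E]]|[nfit E]] := stepP (plan l) x; last first.
  split; rewrite plan_rcons E //; first by move=> b /inA /inl.
  move=> b; rewrite mem_rcons inE => /predU1P[bx|]; last exact: rej.
  move=> _ adb; have := nfit _ bx; rewrite /fits adb /= -ltNge.
  move=> /lt_le_trans; apply; rewrite ler_pM2l //.
  apply: ler_sum_subset; last by move=> k /wA/ltW.
    exact: subseq_uniq sub (map_uniq uA).
  by move=> k /(mem_subseq sub).
have cl : bid c \notin map bid (plan l).2.
  apply/negP => /mapP[k /inA kl ck]; move/negP: xl; apply.
  by apply/mapP; exists (bid k, bjob k) => //=; rewrite -ck -cx.
split; rewrite plan_rcons E /=.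
- rewrite eqxx; exact: subseq_trans (filter_subseq _ _) sub.
- by rewrite cl uA.
- by move=> b; rewrite inE => /predU1P[->|/inA/inl//]; rewrite cx mem_rcons mem_head.
- by move=> b; rewrite inE => /predU1P[->|/adA].
- move=> k k'; rewrite !inE !mem_filter.
  move=> /predU1P[->|/andP[ck kP]] /predU1P[->|/andP[ck' kP']].
  + by rewrite eqxx.
  + by [].
  + by rewrite conflictC.
  + exact: sep.
(* A new booking of weight w adds w to the booked weight and, evicting at most w / 4, at least 3w /
   4 to the live weight. *)
- rewrite !big_cons big_filter.
  move: le43; rewrite (bigID (conflict c)) [X in 4 * X](bigID (conflict c)) /=.
  have : \sum_(k <- (plan l).1 | conflict c k) bwt k <=
         \sum_(k <- (plan l).2 | conflict c k) bwt k.
    apply: ler_sum_subset; last by move=> k /wA/ltW.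
      exact: subseq_uniq sub (map_uniq uA).
    by move=> k /(mem_subseq sub).
  by lra.
- move=> b; rewrite mem_rcons inE => /predU1P[bx|bl].
    by rewrite inE -[bid b]/((bid b, bjob b).1) bx -cx /= eqxx.
  rewrite inE negb_or => /andP[_ bA] adb.
  apply: lt_le_trans (rej _ bl bA adb) _; rewrite ler_pM2l // big_cons.
  have cw : 0 < bwt c by move: wx; rewrite -cx.
  by case: ifP => // _; rewrite lerDr ltW.
Qed.

(** * Order of arrival and the online property *)

Lemma earlier_total : total earlier.
Proof. by move=> x y; exact: le_total. Qed.

Lemma earlier_trans : transitive earlier.
Proof. by move=> y x z; exact: le_trans. Qed.

Definition all_arrivals I := arrivals I predT.

Lemma releasedE I t :
  released I t = [seq x <- all_arrivals I | Defs.rel x.2 <= t].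
Proof.
rewrite /released /all_arrivals /arrivals.
rewrite (filter_sort earlier_total earlier_trans) filter_map.
rewrite (filter_sort leq_total leq_trans) filter_predT.
by congr (sort _ (map _ (sort _ _))); apply: eq_filter.
Qed.

Lemma sorted_filter_cat (T : eqType) (f : T -> R) (s : seq T) (t : R) :
  sorted (fun x y => f x <= f y) s ->
  s = [seq x <- s | f x <= t] ++ [seq x <- s | ~~ (f x <= t)].
Proof.
elim: s => //= a s ih pas; have [fat|fat] := boolP (f a <= t) => /=.
  by rewrite -ih //; exact: path_sorted pas.
have /allP amin : all (fun x => f a <= f x) s.
  by apply: order_path_min pas => y x z; exact: le_trans.
have late x : x \in s -> ~~ (f x <= t).
  by move=> /amin ax; apply: contra fat; exact: le_trans.
rewrite (_ : [seq x <- s | f x <= t] = [::]) /=.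
  by congr cons; apply/esym/all_filterP/allP => x /late.
by apply/eqP; rewrite -[_ == _]negbK -has_filter; apply/hasPn => x /late.
Qed.

Lemma alg_online : online alg.
Proof.
move=> I I' t revE i s st; rewrite /alg /run; congr (omap _ (densest (active _.1 _ _))).
congr plan; rewrite /released /arrivals; congr sort.
have revP j : (j \in ids I) && (Defs.rel (dat I j) <= s) ->
    (j \in ids I') && (Defs.rel (dat I' j) <= s) /\ dat I j = dat I' j.
  move=> /andP[jI rs]; have := revE j; rewrite /revealed jI (le_trans rs st) /=.
  by case: ifP => // /andP[jI' _] [E]; rewrite -E rs jI'.
have revP' j : (j \in ids I') && (Defs.rel (dat I' j) <= s) ->
    (j \in ids I) && (Defs.rel (dat I j) <= s).
  move=> /andP[jI rs]; have := revE j; rewrite /revealed jI (le_trans rs st) /=.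
  by case: ifP => // /andP[jI' _] [E]; rewrite E rs jI'.
have -> : sort leq [seq j <- undup (ids I') | Defs.rel (dat I' j) <= s] =
          sort leq [seq j <- undup (ids I) | Defs.rel (dat I j) <= s].
  apply/perm_sortP; [exact: leq_total|exact: leq_trans|exact: anti_leq|].
  apply: uniq_perm; rewrite ?filter_uniq ?undup_uniq // => j.
  rewrite !mem_filter !mem_undup andbC [RHS]andbC.
  by apply/idP/idP => [/revP'|/revP[]].
apply/eq_in_map => j; rewrite mem_sort mem_filter mem_undup andbC => /revP[_ ->].
by [].
Qed.

Lemma densestP s b : densest s = Some b ->
  b \in s /\ {in s, forall k, bdens k <= bdens b}.
Proof.
rewrite /densest => h.
have : b \in [seq b <- s | all (fun k => bdens k <= bdens b) s].
  by move: h; case: [seq _ <- _ | _] => //= a u [->]; exact: mem_head.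
by rewrite mem_filter => /andP[/allP].
Qed.

Lemma densest_neq_nil s : s != [::] -> densest s != None.
Proof.
move=> /(seq_argmax bdens)[x xs xmax]; rewrite /densest.
have : x \in [seq b <- s | all (fun k => bdens k <= bdens b) s].
  by rewrite mem_filter xs andbT; apply/allP.
by case: [seq _ <- _ | _].
Qed.

(** * Feasibility of the schedule *)

Section Valid.
Variable I : instance R m.
Hypothesis valid : valid_instance I.

Definition booked := (plan (all_arrivals I)).2.
Definition final := (plan (all_arrivals I)).1.

Lemma arrivals_fst P :
  perm_eq (map fst (arrivals I P)) [seq j <- undup (ids I) | P (dat I j)].
Proof.
apply: (@perm_trans _ (map fst [seq (j, dat I j) | j <-
    sort leq [seq j <- undup (ids I) | P (dat I j)]])).
  by apply: perm_map; rewrite perm_sort.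
by rewrite -map_comp map_id_in // perm_sort.
Qed.

Lemma arrivals_uniq P : uniq (map fst (arrivals I P)).
Proof.
by rewrite (perm_uniq (arrivals_fst P)) filter_uniq // undup_uniq.
Qed.

Lemma mem_arrivals P x :
  (x \in arrivals I P) = [&& x.1 \in ids I, P x.2 & x.2 == dat I x.1].
Proof.
rewrite mem_sort; apply/mapP/and3P => [[j]|[xI Px /eqP xE]].
  by rewrite mem_sort mem_filter mem_undup => /andP[Pj jI] ->.
exists x.1; last by rewrite -xE; case: (x).
by rewrite mem_sort mem_filter mem_undup -xE Px.
Qed.

Lemma arrivals_plan P : plan_spec (arrivals I P).
Proof.
apply: planP; first exact: arrivals_uniq.
by move=> x; rewrite mem_arrivals => /and3P[xI _ /eqP ->]; have [] := valid xI.
Qed.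

(** The jobs released by time t form a prefix of the arrivals, so the plan recomputed at time t is
    an intermediate state of one single run. *)
Lemma all_arrivals_cat t :
  all_arrivals I = released I t ++ [seq x <- all_arrivals I | ~~ (Defs.rel x.2 <= t)].
Proof.
rewrite releasedE; apply: (sorted_filter_cat (f := fun x => Defs.rel x.2)).
by apply: sort_sorted; exact: earlier_total.
Qed.

(** Jobs arriving after t only add bookings of their own, and an evicted booking never returns. *)
Lemma final_live t b : b \in final -> Defs.rel (bjob b) <= t ->
  b \in (plan (released I t)).1.
Proof.
rewrite /final (all_arrivals_cat t) => /plan_live_cat[//|].
by rewrite mem_filter /= => /andP[/negP].
Qed.

Lemma released_booked t : {subset (plan (released I t)).2 <= booked}.
Proof. by rewrite /booked (all_arrivals_cat t); exact: plan_booked_sub. Qed.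

Lemma bookedP b : b \in booked ->
  [/\ bid b \in ids I, bjob b = dat I (bid b) & admissible b].
Proof.
have [_ _ inA adA _ _ _] := arrivals_plan predT.
move=> bA; have := inA _ bA; rewrite mem_arrivals => /and3P[bI _ /eqP bE].
by split => //; exact: adA.
Qed.

Lemma runP i t b : run I i t = Some b ->
  [/\ b \in (plan (released I t)).1, b \in booked, bmach b = i, bstart b <= t < bend b &
   {in active (plan (released I t)).1 i t, forall k, bdens k <= bdens b}].
Proof.
move=> /densestP[]; rewrite mem_filter => /andP[/andP[/eqP bi bt] bP] bmax.
split => //; apply: (@released_booked t).
by apply: mem_subseq bP; exact: live_booked (arrivals_plan _).
Qed.

(** [run] depends on t only through comparisons with release dates and window endpoints. *)
Lemma measurable_run (Q : option booking -> Prop) i :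
  measurable [set t | Q (run I i t)]%classic.
Proof.
apply: (@measurable_thresholds _ ([seq Defs.rel x.2 | x <- all_arrivals I] ++
  [seq bstart b | b <- booked] ++ [seq bend b | b <- booked])) => t t' /= Qt tt'.
suff <- : run I i t = run I i t' by [].
have same c : c \in [seq Defs.rel x.2 | x <- all_arrivals I] ++
    [seq bstart b | b <- booked] ++ [seq bend b | b <- booked] ->
    (c <= t) = (c <= t') by exact: tt'.
have relE : released I t = released I t'.
  rewrite !releasedE; apply: eq_in_filter => x xL; apply: same.
  by rewrite mem_cat (map_f (fun x => Defs.rel x.2)).
rewrite /run -relE; congr densest; apply: eq_in_filter => b bP.
have bA : b \in booked.
  apply: (@released_booked t).
  by apply: mem_subseq bP; exact: live_booked (arrivals_plan _).
have sameb f : f = bstart \/ f = bend -> (f b <= t) = (f b <= t').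
  by move=> fE; apply: same; rewrite !mem_cat; case: fE => ->; rewrite (map_f _ bA) ?orbT.
by rewrite !ltNge !sameb; [|right|left].
Qed.

(** This is what keeps a job from running on two machines at once. *)
Lemma live_inj t b b' : b \in (plan (released I t)).1 ->
  b' \in (plan (released I t)).1 -> bid b = bid b' -> b = b'.
Proof.
have [/mem_subseq sub uA _ _ _ _ _] := arrivals_plan (fun x => Defs.rel x <= t).
by move=> /sub bP /sub bP'; exact: (uniq_map_inj uA).
Qed.

Lemma alg_feasible : feasible I (alg I).
Proof.
split.
- move=> i j; have := measurable_run (fun o => omap bid o = Some j) i; exact.
- move=> i t j; rewrite /alg; case E: (run I i t) => [b|] //= [<-].
  have [_ bA _ /andP[bt _] _] := runP E.
  have [bI bE /and3P[_ rb _]] := bookedP bA.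
  by split=> //; rewrite -bE; exact: le_trans rb bt.
- move=> i i' t j; rewrite /alg.
  case E: (run I i t) => [b|] //= [bj]; case E': (run I i' t) => [b'|] //= [bj'].
  have [bP _ <- _ _] := runP E; have [bP' _ <- _ _] := runP E'.
  by congr bmach; apply: (live_inj bP bP'); rewrite bj bj'.
Qed.

End Valid.
End Algorithm.

(** * Competitiveness *)

Section Competitive.
Variables (R : realType) (m : nat) (I : instance R m) (eps : R).
Hypothesis valid : valid_instance I.
Hypothesis eps0 : 0 < eps.
Hypothesis slack : has_slack eps I.

Local Open Scope classical_set_scope.
Notation mu := (@lebesgue_measure R).
Let G : R := Num.max 1 eps^-1.

Lemma one_le_G : 1 <= G. Proof. by rewrite le_max lexx. Qed.

(** The slack enters here, through p <= G (len - p): if len = 2p this is G >= 1, and otherwise len -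
    p = d - r - p >= eps p with G eps >= 1. *)
Lemma booking_bounds (b : booking R m) :
  bid b \in ids I -> bjob b = dat I (bid b) -> isSome (ptime (bjob b) (bmach b)) ->
  [/\ 0 < bproc b, 0 < bwt b, bproc b < blen b, blen b <= 2 * bproc b &
      bgap b <= 8 * G * bdens b].
Proof.
move=> bI bE; have [w0 p0] := valid bI; have := slack bI.
rewrite /bgap /bdens /blen /bproc /bwt -bE in w0 p0 *.
case pE : (ptime (bjob b) (bmach b)) => [p|] //= sl _.
have pp := p0 _ _ pE; have slp := sl _ _ pE.
set D := dl (bjob b) - Defs.rel (bjob b) in slp *.
have Gp : p <= G * (Num.min (2 * p) D - p).
  have G1 := one_le_G; have Ge : 1 <= G * eps.
    by rewrite -(mulVf (lt0r_neq0 eps0)) ler_pM2r // le_max lexx orbT.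
  case: (leP (2 * p) D) => _.
    by have := ler_wpM2r (ltW pp) G1; lra.
  have : p * 1 <= p * (G * eps) by rewrite ler_pM2l.
  by have := ler_wpM2l (le_trans ler01 G1) slp; lra.
have pmin : p < Num.min (2 * p) D.
  by by have := mulr_gt0 eps0 pp; rewrite lt_min => ep; apply/andP; split; lra.
split => //; first by rewrite ge_min lexx.
rewrite ler_pdivrMr; last lra.
set w := wt (bjob b) in w0 *; set q := _ - p in Gp *.
have -> : 8 * G * (w / p) * q = 8 * w * (G * q / p).
  by field; exact: lt0r_neq0.
by rewrite ler_peMr ?ler_pdivlMr ?mul1r // mulr_ge0 // ltW.
Qed.

Lemma booked_bounds b : b \in booked I ->
  [/\ 0 < bproc b, 0 < bwt b, bproc b < blen b, blen b <= 2 * bproc b &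
      bgap b <= 8 * G * bdens b].
Proof. by move=> /(bookedP valid)[bI bE /andP[pb _]]; exact: booking_bounds. Qed.

Lemma booked_dens_gt0 b : b \in booked I -> 0 < bdens b.
Proof. by move=> /booked_bounds[p0 w0 _ _ _]; exact: divr_gt0. Qed.

Lemma booked_gap_gt0 b : b \in booked I -> 0 < bgap b.
Proof.
move=> /booked_bounds[p0 w0 pl _ _]; apply: divr_gt0; last by rewrite subr_gt0.
by rewrite mulr_gt0.
Qed.

Lemma final_booked : {subset final I <= booked I}.
Proof. exact: mem_subseq (live_booked (arrivals_plan valid predT)). Qed.

Lemma final_uniq : uniq (map (@bid R m) (final I)).
Proof.
have [sub uA _ _ _ _ _] := arrivals_plan valid predT.
exact: subseq_uniq (map_subseq _ sub) uA.
Qed.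

(** * Interruptions and the completed share of the booked weight *)

Definition running (b : booking R m) : set R := [set t | run I (bmach b) t = Some b].
Definition window (b : booking R m) : set R := [set` `[bstart b, bend b[%R].
(* For a surviving booking, the part of its window spent on other bookings. *)
Definition lost (b : booking R m) : set R := window b `\` running b.

Lemma measurable_running b : measurable (running b).
Proof. exact: (measurable_run valid (fun o => o = Some b)). Qed.

Lemma measurable_window b : measurable (window b).
Proof. by rewrite /window; exact: measurable_itv. Qed.

Lemma measurable_lost b : measurable (lost b).
Proof. by apply: measurableD; [exact: measurable_window|exact: measurable_running]. Qed.

Lemma running_window b : running b `<=` window b.
Proof. by move=> t /(runP valid)[_ _ _ bt _]; rewrite /window /= in_itv. Qed.

(** On each machine the interrupted bookings are pairwise separated by [above] and lie below the
    running one, so [sum_gaps_le] bounds their gaps by its density. The right side ranges over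
    [booked], since the running booking may be evicted later. *)
Lemma interruption_le t :
  \sum_(b <- final I) bgap b * (t \in lost b)%:R <=
  \sum_(b <- booked I) bdens b * (t \in running b)%:R.
Proof.
rewrite (partition_big (@bmach R m) predT) //=.
rewrite [leRHS](partition_big (@bmach R m) predT) //=.
apply: ler_sum => i _.
set P := (plan (released I t)).1.
have lostP b : b \in final I -> t \in lost b ->
    [/\ b \in active P (bmach b) t, b \in booked I & run I (bmach b) t != Some b].
  move=> bF; rewrite inE => -[]; rewrite /window /= in_itv /= => bt nrun.
  have bA := final_booked bF; split => //; last by apply/eqP.
  rewrite mem_filter eqxx bt /=; apply: final_live => //.
  have [_ _ /and3P[_ rb _]] := bookedP valid bA.
  by case/andP: bt => bt _; exact: le_trans rb bt.
have sepP : {in P &, forall k k', k != k' -> ~~ conflict k k'}.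
  exact: live_separated (arrivals_plan valid _).
have rhs0 : 0 <= \sum_(b <- booked I | bmach b == i) bdens b * (t \in running b)%:R.
  rewrite big_seq_cond; apply: sumr_ge0 => b /andP[/booked_dens_gt0 /ltW d0 _].
  exact: mulr_ge0.
case E: (run I i t) => [c|]; last first.
  rewrite big_seq_cond big1 // => b /andP[bF /eqP bi].
  case tl: (t \in lost b); last by rewrite mulr0.
  have [bact _ _] := lostP _ bF tl; rewrite bi in bact.
  have : active P i t != [::] by apply: contraTneq bact => ->.
  by move=> /densest_neq_nil; rewrite -/(run I i t) E.
have [cP cA ci ct cmax] := runP valid E.
have le_c : bdens c <=
    \sum_(b <- booked I | bmach b == i) bdens b * (t \in running b)%:R.
  rewrite -big_filter (big_rem c) /=; last by rewrite mem_filter ci eqxx.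
  rewrite (_ : t \in running c); last by rewrite inE /running /= ci.
  rewrite mulr1 lerDl big_seq; apply: sumr_ge0 => b /mem_rem.
  rewrite mem_filter => /andP[_ /booked_dens_gt0/ltW d0]; exact: mulr_ge0.
apply: le_trans le_c.
rewrite (eq_bigr (fun b => if t \in lost b then bgap b else 0)); last first.
  by move=> b _; case: ifP; rewrite ?mulr1 ?mulr0.
rewrite -big_mkcondr -big_filter.
set s := [seq _ <- _ | _].
have sP b : b \in s -> [/\ b \in active P i t, b \in booked I & b != c].
  rewrite mem_filter => /andP[/andP[/eqP bi tl] bF].
  have [h1 h2 h3] := lostP _ bF tl; rewrite bi in h1 h3; split => //.
  by apply: contra h3 => /eqP ->; rewrite E.
have cact : c \in active P i t by rewrite mem_filter ci eqxx ct.
have sepact k l : k \in active P i t -> l \in active P i t -> k != l ->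
    above k l \/ above l k.
  rewrite !mem_filter => /andP[/andP[/eqP ki /andP[k1 k2]] kP].
  move=> /andP[/andP[/eqP li /andP[l1 l2]] lP] kl.
  have := sepP _ _ kP lP kl; rewrite /conflict ki li eqxx /=.
  rewrite (le_lt_trans k1 l2) (le_lt_trans l1 k2) /= negb_and !negbK.
  by case/orP; [left|right].
apply: (sum_gaps_le (v := @bdens R m)).
- by apply: filter_uniq; exact: map_uniq final_uniq.
- exact/ltW/booked_dens_gt0.
- by move=> k /sP[_ /booked_dens_gt0/ltW].
- by move=> k /sP[_ /booked_gap_gt0].
- by move=> k l /sP[ka _ _] /sP[la _ _] kl; exact: sepact.
- move=> k /sP[ka kA kc]; case: (sepact _ _ ka cact kc) => // ck.
  have := booked_gap_gt0 cA; have := cmax _ ka; move: ck; rewrite /above; lra.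
Qed.

(** A booking that runs for [bproc] within its window completes. On failure it thus loses more than
    [blen - bproc], and this difference times [bgap] is 8w. *)
Lemma failed_lost b : b \in final I -> ~ completed I (alg I) (bid b) ->
  8 * bwt b <= bgap b * vol (lost b).
Proof.
move=> bF nc; have bA := final_booked bF.
have [bI bE /and3P[pb rb ed]] := bookedP valid bA.
have [p0 w0 pl _ _] := booked_bounds bA.
have finw : (mu (window b) < +oo)%E.
  by apply: (@mu_itv_lty _ true true (bstart b) (bend b)) => //; exact: measurable_window.
have volw : vol (window b) = blen b.
  by rewrite vol_itv; rewrite /bend; lra.
have finr : (mu (running b) < +oo)%E.
  by apply: (@mu_itv_lty _ true true (bstart b) (bend b));
    [exact: measurable_running|exact: running_window].
have volr : vol (running b) < bproc b.
  rewrite ltNge; apply/negP => h; apply: nc; rewrite /completed.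
  rewrite (bigD1 (bmach b)) //=.
  move: h; rewrite /bproc bE; rewrite bE in pb.
  case pE: (ptime (dat I (bid b)) (bmach b)) pb => [p|] //= _ h.
  have pp : 0 < p by have [_ /(_ _ _ pE)] := valid bI.
  have h1 : (1%:E <= proc_by_deadline I (alg I) (bmach b) (bid b) * (p^-1)%:E)%E.
    apply: (@le_trans _ _ (mu (running b) * (p^-1)%:E)%E).
      rewrite -(@fineK _ (mu (running b))) ?ge0_fin_numE // -EFinM lee_fin.
      by rewrite ler_pdivlMr ?mul1r.
    apply: lee_wpmul2r; first by rewrite lee_fin invr_ge0 ltW.
    rewrite /proc_by_deadline; apply: le_measure; rewrite ?inE.
    - exact: measurable_running.
    - apply: measurableI; first by have [mS _ _] := alg_feasible valid; exact: mS.
      exact: measurable_le_set.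
    - move=> t tr; split; first by rewrite /= /alg tr.
      move: (running_window tr); rewrite /window /= in_itv /= -bE => /andP[_ tb].
      exact: le_trans (ltW tb) ed.
  apply: le_trans h1 _; rewrite leeDl //; apply: sume_ge0 => i _.
  case pi: (ptime _ i) => [q|] //; apply: mule_ge0 => //.
  by rewrite lee_fin invr_ge0 ltW //; have [_ /(_ _ _ pi)] := valid bI.
have voll : vol (lost b) = blen b - vol (running b).
  rewrite /lost /vol measureD //; [|exact: measurable_window|exact: measurable_running].
  rewrite setIC (setIidl (@running_window b)) fineB ?ge0_fin_numE // -/(vol _) -/(vol _).
  by rewrite volw.
rewrite /bgap mulrAC ler_pdivlMr; last lra.
apply: ler_wpM2l; first by rewrite mulr_ge0 // ltW.
rewrite voll; lra.
Qed.

(** Let B be the booked weight. At least 3B / 4 survives. Running times are at most 2p, so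
    integrating [interruption_le] bounds 8 times the failed weight by 2B; at least 3B / 4 - B / 4 is
    completed. *)
Lemma booked_le_throughput :
  \sum_(b <- booked I) bwt b <= 2 * throughput I (alg I).
Proof.
pose ok (b : booking R m) := `[< completed I (alg I) (bid b) >].
have le34 : 3 * \sum_(b <- booked I) bwt b <= 4 * \sum_(b <- final I) bwt b.
  exact: booked_le_live (arrivals_plan valid predT).
have comp : \sum_(b <- final I | ok b) bwt b <= throughput I (alg I).
  rewrite /throughput.
  rewrite [leLHS](_ : _ = \sum_(j <- map (@bid R m) (final I) | `[< completed I (alg I) j >])
      wt (dat I j)).
    apply: ler_sum_subset; first exact: final_uniq.
      move=> j /mapP[b /final_booked/(bookedP valid)[bI _ _] ->] ok'.
      by rewrite mem_undup.
    by move=> j; rewrite mem_undup => /valid[/ltW].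
  rewrite big_map big_seq_cond [RHS]big_seq_cond; apply: eq_bigr => b /andP[bF _].
  by have [_ bE _] := bookedP valid (final_booked bF); rewrite /bwt bE.
have fail : 8 * \sum_(b <- final I | ~~ ok b) bwt b <= 2 * \sum_(b <- booked I) bwt b.
  apply: (@le_trans _ _ (\sum_(b <- final I) bgap b * vol (lost b))).
    rewrite mulr_sumr [leRHS](bigID ok) /= -[leLHS]add0r; apply: lerD.
      rewrite big_seq_cond; apply: sumr_ge0 => b /andP[bF _].
      apply: mulr_ge0; last exact: fine_ge0.
      exact/ltW/booked_gap_gt0/final_booked.
    rewrite big_seq_cond [leRHS]big_seq_cond; apply: ler_sum => b /andP[bF nok].
    by apply: failed_lost => //; apply/asboolPn.
  apply: (@le_trans _ _ (\sum_(b <- booked I) bdens b * vol (running b))).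
    apply: vol_simple_le.
    - exact: measurable_lost.
    - exact: measurable_running.
    - move=> b; apply: (@mu_itv_lty _ true true (bstart b) (bend b)).
        exact: measurable_lost.
      by move=> t [].
    - move=> b; apply: (@mu_itv_lty _ true true (bstart b) (bend b)).
        exact: measurable_running.
      exact: running_window.
    - by move=> b /final_booked/booked_gap_gt0/ltW.
    - by move=> b /booked_dens_gt0/ltW.
    - exact: interruption_le.
  rewrite mulr_sumr big_seq [leRHS]big_seq; apply: ler_sum => b bA.
  have [p0 w0 pl l2 _] := booked_bounds bA.
  have -> : 2 * bwt b = bdens b * (2 * bproc b) by rewrite /bdens; field; lra.
  apply: ler_wpM2l; first exact/ltW/booked_dens_gt0.
  apply: le_trans l2.
  have <- : vol (window b) = blen b by rewrite vol_itv; rewrite /bend; lra.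
  apply: fine_le; rewrite ?ge0_fin_numE //.
  - apply: (@mu_itv_lty _ true true (bstart b) (bend b)).
      exact: measurable_running.
    exact: running_window.
  - by apply: (@mu_itv_lty _ true true (bstart b) (bend b)) => //; exact: measurable_window.
  - apply: le_measure; rewrite ?inE; [exact: measurable_running|exact: measurable_window|].
    exact: running_window.
move: le34; rewrite [X in _ <= 4 * X](bigID ok) /=; lra.
Qed.

(** * Bounding an offline schedule by the booked weight *)

Section Offline.
Variable S : schedule R m.
Hypothesis Sfeas : feasible I S.

(** The start 0 is a dummy, as [blen] does not depend on it. *)
Definition slot_length (i : 'I_m) (j : nat) : R := blen (Booking j (dat I j) i 0).

(* The window of a rejected job on machine i is covered by the consecutive
   intervals of one slot length, the last one being shifted back to the deadline. *)
Definition slot (i : 'I_m) (x : nat * nat) : booking R m :=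
  Booking x.1 (dat I x.1) i
    (Num.min (Defs.rel (dat I x.1) + x.2%:R * slot_length i x.1)
             (dl (dat I x.1) - slot_length i x.1)).

Definition work (i : 'I_m) (j : nat) : set R :=
  [set t | S i t = Some j /\ t <= dl (dat I j)].

(** Cutting at the unshifted half-open boundaries keeps pieces disjoint. As [work] stops at the
    deadline, a piece still lies inside its possibly shifted slot. *)
Definition piece (i : 'I_m) (x : nat * nat) : set R :=
  work i x.1 `&`
  [set` `[(Defs.rel (dat I x.1) + x.2%:R * slot_length i x.1),
          (Defs.rel (dat I x.1) + x.2.+1%:R * slot_length i x.1)[%R].

Definition rejected (i : 'I_m) : seq nat :=
  [seq j <- undup (ids I) |
    (j \notin map (@bid R m) (booked I)) && isSome (ptime (dat I j) i)].

Definition pieces (i : 'I_m) (N : nat) : seq (nat * nat) :=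
  [seq (j, n) | j <- rejected i, n <- iota 0 N].

Lemma measurable_work i j : measurable (work i j).
Proof.
apply: measurableI; last exact: measurable_le_set.
by have [mS _ _] := Sfeas; exact: mS.
Qed.

Lemma measurable_piece i x : measurable (piece i x).
Proof. by apply: measurableI; [exact: measurable_work|exact: measurable_itv]. Qed.

Lemma work_window i j :
  work i j `<=` [set` `[Defs.rel (dat I j), dl (dat I j)]%R].
Proof.
have [_ Srel _] := Sfeas; move=> t [St td].
by rewrite /= in_itv /= td andbT; have [] := Srel _ _ _ St.
Qed.

Lemma work_fin i j : (mu (work i j) < +oo)%E.
Proof. exact: mu_itv_lty (measurable_work i j) (@work_window i j). Qed.

Lemma piece_fin i x : (mu (piece i x) < +oo)%E.
Proof.
apply: (mu_itv_lty (measurable_piece i x)) => t -[_]; exact.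
Qed.

Lemma rejectedP i j : j \in rejected i ->
  [/\ j \in ids I, j \notin map (@bid R m) (booked I) & isSome (ptime (dat I j) i)].
Proof. by rewrite mem_filter mem_undup => /andP[/andP[]]. Qed.

Lemma slot_bounds i j n : j \in rejected i ->
  [/\ 0 < bproc (slot i (j, n)), 0 < bwt (slot i (j, n)),
      bproc (slot i (j, n)) < blen (slot i (j, n)),
      blen (slot i (j, n)) <= 2 * bproc (slot i (j, n)) &
      bgap (slot i (j, n)) <= 8 * G * bdens (slot i (j, n))].
Proof. by move=> /rejectedP[jI _ pj]; exact: booking_bounds. Qed.

Lemma slot_length_gt0 i j : j \in rejected i -> 0 < slot_length i j.
Proof. by move=> /(slot_bounds 0)[p0 _ pl _ _]; exact: lt_trans p0 pl. Qed.

Lemma slot_admissible i j n : j \in rejected i -> admissible (slot i (j, n)).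
Proof.
move=> jr; have [_ _ pj] := rejectedP jr; have L0 := slot_length_gt0 jr.
rewrite /admissible /= pj /= /bend /= -[blen _]/(slot_length i j).
have LD : slot_length i j <= dl (dat I j) - Defs.rel (dat I j).
  by rewrite /slot_length /blen ge_min lexx orbT.
apply/andP; split.
  have nL0 : 0 <= n%:R * slot_length i j by rewrite mulr_ge0 // ltW.
  by rewrite le_min lerDl nL0 /=; lra.
by rewrite -lerBrDr ge_min lexx orbT.
Qed.

Lemma piece_slot i x :
  piece i x `<=` [set` `[bstart (slot i x), bend (slot i x)]%R].
Proof.
case: x => j n t [] [_ td]; rewrite /= !in_itv /= /bend /= -[blen _]/(slot_length i j).
move=> /andP[t1 t2]; rewrite ge_min t1 /=.
rewrite -lerBlDr le_min; apply/andP; split; last by rewrite lerD2r.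
by move: t2; rewrite -natr1; lra.
Qed.

Lemma piece_inj i t : {in [pred x | x.1 \in rejected i] &, forall x y,
  t \in piece i x -> t \in piece i y -> x = y}.
Proof.
move=> [j n] [j' n']; rewrite !inE /= => jr _ [[Sj _]] h [[Sj' _]] h'.
have jj' : j = j' by move: Sj; rewrite Sj' => -[].
rewrite -{}jj' {j' Sj'} in h' *; have L0 := slot_length_gt0 jr.
move: h h'; rewrite /= !in_itv /= => /andP[h1 h2] /andP[h3 h4].
have lt1 : (n < n'.+1)%N.
  by rewrite -(ltr_nat R) -(ltr_pM2r L0); lra.
have lt2 : (n' < n.+1)%N.
  by rewrite -(ltr_nat R) -(ltr_pM2r L0); lra.
by congr pair; apply/eqP; rewrite eqn_leq -ltnS lt1 -ltnS lt2.
Qed.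

Lemma piecesP i N x : x \in pieces i N -> x.1 \in rejected i.
Proof. by move=> /allpairsP[[j n] [/= jr _ ->]]. Qed.

Lemma pieces_work_le i N :
  \sum_(x <- pieces i N) bdens (slot i x) * vol (piece i x) <=
  454 * (1 + 8 * G) * \sum_(k <- booked I | bmach k == i) bwt k.
Proof.
have G1 := one_le_G; rewrite -[in leRHS]big_filter.
have upieces : uniq (pieces i N).
  apply: allpairs_uniq; [by rewrite filter_uniq ?undup_uniq|exact: iota_uniq|].
  by move=> [? ?] [? ?] _ _ [-> ->].
have QP k : k \in [seq b <- booked I | bmach b == i] -> bmach k = i /\ k \in booked I.
  by rewrite mem_filter => /andP[/eqP].
(* Source of the factor 1 + 8G passed to [charging]: without separation, k exceeds b in density by
   less than the gap of b. *)
have dens_lt (b k : booking R m) : bgap b <= 8 * G * bdens b -> ~~ above b k ->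
    bdens k <= (1 + 8 * G) * bdens b.
  by rewrite /above -ltNge => h1 h2; apply: le_trans (ltW h2) _; lra.
apply: (@charging R _ _ (pieces i N) [seq b <- booked I | bmach b == i]
  (fun x => bstart (slot i x)) (fun x => bproc (slot i x))
  (fun x => blen (slot i x)) (fun x => bdens (slot i x))
  (fun x => vol (piece i x)) (@bstart R m) (@bproc R m) (@blen R m) (@bwt R m)
  (fun x k => conflict (slot i x) k)) => //.
- by lra.
- move=> [j n] /piecesP /= jr; have [p0 w0 pl l2 _] := slot_bounds n jr.
  by split => //; [exact: divr_gt0|exact: fine_ge0].
- by move=> [j n] /piecesP /= jr; have [p0 w0 pl l2 _] := slot_bounds n jr; lra.
- move=> k /QP[_ kA]; have [p0 w0 pl l2 _] := booked_bounds kA.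
  by split => //; lra.
- move=> [j n] k /piecesP /= jr /QP[_ kA] /and4P[_ c1 c2 /andP[n1 n2]].
  have [_ _ _ _ g1] := slot_bounds n jr; have [_ _ _ _ g2] := booked_bounds kA.
  split; [exact: ltW|exact: ltW| |]; exact: dens_lt.
- move=> [j n] /piecesP /= jr; have [p0 w0 _ _ _] := slot_bounds n jr.
  have [jI jA _] := rejectedP jr.
  rewrite /bdens mulfVK ?lt0r_neq0 //.
  have := @rejected_conflict _ _ _ (arrivals_plan valid predT) (slot i (j, n)).
  rewrite mem_arrivals /= jI eqxx => /(_ isT jA (slot_admissible n jr)) /ltW.
  move=> /le_trans; apply; rewrite ler_pM2l // big_filter_cond.
  rewrite le_eqVlt; apply/orP; left; apply/eqP; apply: eq_bigl => k.
  by rewrite /conflict eq_sym /=; case: (bmach k == i).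
(* The pieces on one machine are disjoint and lie in their slots, so those of slots inside [a, b]
   fit into b - a. *)
- move=> a b ab.
  rewrite -big_filter -(vol_itv true false ab); apply: sum_vol_le.
  + exact: filter_uniq.
  + exact: measurable_piece.
  + exact: measurable_itv.
  + exact: piece_fin.
  + exact: mu_itv_lty (measurable_itv _) (@subset_refl _ _).
  + move=> t x y; rewrite !mem_filter => /andP[_ /piecesP xr] /andP[_ /piecesP yr].
    exact: piece_inj.
  + move=> t x; rewrite mem_filter => /andP[/andP[ax xb] _]; rewrite !inE => /piece_slot.
    rewrite /= !in_itv /= => /andP[h1 h2].
    by rewrite (le_trans ax h1) (le_trans h2 xb).
Qed.

Lemma work_le_pieces i j N : j \in rejected i ->
  (dl (dat I j) - Defs.rel (dat I j)) / slot_length i j < N%:R ->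
  vol (work i j) <= \sum_(n <- iota 0 N) vol (piece i (j, n)).
Proof.
move=> jr DN; have L0 := slot_length_gt0 jr.
apply: vol_le_sum.
- exact: measurable_work.
- by move=> n; exact: measurable_piece.
- exact: work_fin.
- by move=> n; exact: piece_fin.
move=> t tw; have := work_window tw; rewrite /= in_itv /= => /andP[t1 t2].
pose y := (t - Defs.rel (dat I j)) / slot_length i j.
have y0 : 0 <= y by rewrite divr_ge0 ?subr_ge0 // ltW.
have /andP[n1 n2] := truncn_itv y0; set n := Num.truncn y in n1 n2.
have nN : n \in iota 0 N.
  rewrite mem_iota add0n /= -(ltr_nat R); apply: le_lt_trans n1 _.
  by apply: le_lt_trans DN; rewrite ler_pM2r ?invr_gt0 // lerD2r.
exists n => //; split => //; rewrite /= in_itv /=.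
move: n1 n2; rewrite ler_pdivlMr // ltr_pdivrMr // => n1 n2.
by apply/andP; split; lra.
Qed.

(** Multiplied by the weight, the fraction of j processed on machine i becomes density times work on
    i. From here on each machine is treated on its own, whatever the migration. *)
Lemma rejected_weight_le j N : j \in ids I ->
  j \notin map (@bid R m) (booked I) -> completed I S j ->
  (forall i, j \in rejected i ->
    (dl (dat I j) - Defs.rel (dat I j)) / slot_length i j < N%:R) ->
  wt (dat I j) <= \sum_(i < m) (if j \in rejected i then
     \sum_(n <- iota 0 N) bdens (slot i (j, n)) * vol (piece i (j, n)) else 0).
Proof.
move=> jI jA comp hN; have [w0 p0] := valid jI.
have rejE i : (j \in rejected i) = isSome (ptime (dat I j) i).
  by rewrite mem_filter mem_undup jI jA andbT.
have termE i : (match ptime (dat I j) i with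
      | Some x => proc_by_deadline I S i j * (x^-1)%:E | None => 0 end =
    (if j \in rejected i then vol (work i j) / bproc (slot i (j, 0%N)) else 0)%:E)%E.
  rewrite rejE /bproc /=; case pE: (ptime _ _) => [p|] //=.
  by rewrite EFinM fineK // ge0_fin_numE //; exact: work_fin.
move: comp; rewrite /completed (eq_bigr _ (fun i _ => termE i)) sumEFin lee_fin.
move=> /(ler_wpM2l (ltW w0)); rewrite mulr1 => /le_trans; apply.
rewrite mulr_sumr; apply: ler_sum => i _.
case: ifP => jr; last by rewrite mulr0.
rewrite mulrCA mulrC -[wt _ / _]/(bdens (slot i (j, 0%N))).
rewrite (eq_bigr (fun n => bdens (slot i (j, 0%N)) * vol (piece i (j, n)))) //.
rewrite -mulr_sumr; apply: ler_wpM2l.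
  have [? ? _ _ _] := slot_bounds 0 jr; exact/ltW/divr_gt0.
exact: work_le_pieces (hN _ jr).
Qed.

Lemma offline_le_booked :
  throughput I S <= (1 + 454 * (1 + 8 * G)) * \sum_(b <- booked I) bwt b.
Proof.
have w0 j : j \in undup (ids I) -> 0 <= wt (dat I j).
  by rewrite mem_undup => /valid[/ltW].
(* One number of slots that suffices for all jobs and machines. *)
have [N hN] : exists N : nat, forall j i, j \in rejected i ->
    (dl (dat I j) - Defs.rel (dat I j)) / slot_length i j < N%:R.
  pose r (x : 'I_m * nat) :=
    (dl (dat I x.2) - Defs.rel (dat I x.2)) / slot_length x.1 x.2.
  have : exists N : nat,
      {in [seq (i, j) | i <- enum 'I_m, j <- ids I], forall x, r x < N%:R}.
    elim: [seq _ | _ <- _, _ <- _] => [|x s [N hN]]; first by exists 0%N.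
    exists (maxn N (Num.bound `|r x|)) => y; rewrite inE => /predU1P[->|/hN].
      apply: le_lt_trans (ler_norm _) _; apply: lt_le_trans (archi_boundP _) _ => //.
      by rewrite ler_nat leq_maxr.
    by move=> /lt_le_trans; apply; rewrite ler_nat leq_maxl.
  move=> [N hN]; exists N => j i /rejectedP[jI _ _]; apply: (hN (i, j)).
  by apply/allpairsP; exists (i, j); rewrite mem_enum.
pose isb j := j \in map (@bid R m) (booked I).
pose comp j := `[< completed I S j >].
have accepted : \sum_(j <- undup (ids I) | comp j && isb j) wt (dat I j) <=
    \sum_(b <- booked I) bwt b.
  rewrite [leRHS](_ : _ = \sum_(j <- map (@bid R m) (booked I)) wt (dat I j)).
    apply: ler_sum_subset; first exact: undup_uniq.
      by move=> j _ /andP[].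
    by move=> j /mapP[b /(bookedP valid)[/valid[/ltW ? _] _ _] ->].
  rewrite big_map big_seq [RHS]big_seq; apply: eq_bigr => b /(bookedP valid)[_ bE _].
  by rewrite /bwt bE.
have rej : \sum_(j <- undup (ids I) | comp j && ~~ isb j) wt (dat I j) <=
    454 * (1 + 8 * G) * \sum_(b <- booked I) bwt b.
  rewrite [in leRHS](partition_big (@bmach R m) predT) //= mulr_sumr.
  apply: (@le_trans _ _ (\sum_(i < m) \sum_(x <- pieces i N)
      bdens (slot i x) * vol (piece i x))); last first.
    by apply: ler_sum => i _; exact: pieces_work_le.
  pose F i j := \sum_(n <- iota 0 N) bdens (slot i (j, n)) * vol (piece i (j, n)).
  have F0 i j : j \in rejected i -> 0 <= F i j.
    move=> jr; apply: sumr_ge0 => n _; apply: mulr_ge0; last exact: fine_ge0.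
    have [? ? _ _ _] := slot_bounds n jr; exact/ltW/divr_gt0.
  apply: (@le_trans _ _ (\sum_(j <- undup (ids I) | comp j && ~~ isb j)
      \sum_(i < m) if j \in rejected i then F i j else 0)).
    rewrite big_seq_cond [leRHS]big_seq_cond; apply: ler_sum => j.
    rewrite mem_undup => /and3P[jI /asboolP cj nb].
    by apply: rejected_weight_le => // i; exact: hN.
  rewrite exchange_big; apply: ler_sum => i _.
  rewrite big_allpairs -/(F i _) -big_mkcondr.
  apply: ler_sum_subset; first exact: undup_uniq.
    by move=> j _ /andP[].
  exact: F0.
rewrite /throughput (bigID isb) /= mulrDl mul1r.
exact: lerD.
Qed.

End Offline.

Lemma alg_competitive S : feasible I S ->
  throughput I S <= 100 * 90 * G * throughput I (alg I).
Proof.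
move=> /offline_le_booked h; have G1 := one_le_G.
have h' := booked_le_throughput.
have c0 : 0 <= 1 + 454 * (1 + 8 * G) by lra.
apply: le_trans h _; apply: le_trans (ler_wpM2l c0 h') _.
have t0 : 0 <= throughput I (alg I).
  rewrite /throughput big_seq_cond; apply: sumr_ge0 => j.
  by rewrite mem_undup => /andP[/valid[/ltW]].
(* Twice 1 + 454 (1 + 8G) is 910 + 7264 G, at most 8174 G as G >= 1, hence below 9000 G. *)
rewrite mulrA; apply: ler_wpM2r => //; lra.
Qed.

End Competitive.

Theorem theorem2 (R : realType) :
  exists alg : forall m : nat, instance R m -> schedule R m,
    (forall m, online (alg m)) /\
    exists C : R, 0 < C /\
      forall (eps : R), 0 < eps ->
      forall (m : nat) (I : instance R m),
        valid_instance I -> has_slack eps I ->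
        feasible I (alg m I) /\
        forall S : schedule R m, feasible I S ->
          throughput I S <= C * Num.max 1 eps^-1 * throughput I (alg m I).
Proof.
exists (fun m => @alg R m); split; first by move=> m; exact: alg_online.
exists (100 * 90); split; first by rewrite mulr_gt0 ?ltr0n.
move=> eps eps0 m I valid slack.
split; first exact: alg_feasible.
by move=> S; exact: alg_competitive.
Qed.
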